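(* Let $(\mathcal{N},[\cdot,\ldots,\cdot]_{\mathcal{N}})$ and $(\mathcal{N}',[\cdot,\ldots,\cdot]_{\mathcal{N}'})$ be two $n$-Lie algebras over $\mathbb{K}$, and let $\Theta_t=([\cdot,\ldots,\cdot]_{\mathcal{N},t},[\cdot,\ldots,\cdot]_{\mathcal{N}',t},\phi_t)$ be a deformation of an $n$-Lie algebra morphism $\phi:\mathcal{N}\to\mathcal{N}'$. Then: (1) The infinitesimal $\theta_1$ of the deformation $\Theta_t$ of $\phi$ is a $2$-cocycle, $\theta_1\in Z^2(\phi,\phi)$, whose cohomology class in $H^2(\phi,\phi)$ is determined by the equivalence class of $\Theta_t$. (2) There exists an equivalent deformation $\widetilde\Theta_t=([\cdot,\ldots,\cdot]_{\mathcal{N},t},[\cdot,\ldots,\cdot]_{\mathcal{N}',t},\widetilde\phi_t)$ such that its infinitesimal $\widetilde\theta_1$ satisfies $\widetilde\theta_1\in Z^2(\phi,\phi)$ and $\widetilde\theta_1\notin B^2(\phi,\phi)$. Hence, if $H^2(\phi,\phi)=0$, then every formal deformation of $\phi$ is equivalent to a trivial deformation.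
   Context: $\mathbb{K}$ is an algebraically closed field of characteristic $0$; all vector spaces are over $\mathbb{K}$. An $n$-Lie algebra is a vector space $\mathcal{N}$ with a skew-symmetric $n$-linear bracket satisfying the Nambu identity $[x_1,\ldots,x_{n-1},[y_1,\ldots,y_n]]=\sum_{i=1}^n[y_1,\ldots,y_{i-1},[x_1,\ldots,x_{n-1},y_i],y_{i+1},\ldots,y_n]$. A morphism of $n$-Lie algebras is a linear map $f:\mathcal{N}\to\mathcal{N}'$ with $f([x_1,\ldots,x_n]_{\mathcal{N}})=[f(x_1),\ldots,f(x_n)]_{\mathcal{N}'}$. Below, $[\cdot,\ldots,\cdot]$ and $[\cdot,\ldots,\cdot]'$ abbreviate the brackets of $\mathcal{N}$ and $\mathcal{N}'$. Deformations. $\mathcal{N}[\![t]\!]$ is the space of formal power series with coefficients in $\mathcal{N}$; $\mathbb{K}$-multilinear maps are extended $\mathbb{K}[\![t]\!]$-multilinearly. A one-parameter formal deformation of $\mathcal{N}$ is $[\cdot,\ldots,\cdot]_{\mathcal{N},t}=\sum_{i\ge0}t^i[\cdot,\ldots,\cdot]_{\mathcal{N},i}$ with each $[\cdot,\ldots,\cdot]_{\mathcal{N},i}:\mathcal{N}^n\to\mathcal{N}$ skew-symmetric and $n$-linear, $[\cdot,\ldots,\cdot]_{\mathcal{N},0}=[\cdot,\ldots,\cdot]_{\mathcal{N}}$, satisfying the Nambu identity. A (formal) deformation of $\phi$ is a triple $\Theta_t=([\cdot,\ldots,\cdot]_{\mathcal{N},t},[\cdot,\ldots,\cdot]_{\mathcal{N}',t},\phi_t)$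 where the first two entries are formal deformations of $\mathcal{N}$ and $\mathcal{N}'$, and $\phi_t=\sum_{i\ge0}\phi_it^i$, with $\phi_i:\mathcal{N}\to\mathcal{N}'$ linear and $\phi_0=\phi$, satisfies $\phi_t([x_1,\ldots,x_n]_{\mathcal{N},t})=[\phi_t(x_1),\ldots,\phi_t(x_n)]_{\mathcal{N}',t}$. Write $\theta_i=([\cdot,\ldots,\cdot]_{\mathcal{N},i},[\cdot,\ldots,\cdot]_{\mathcal{N}',i},\phi_i)$, and similarly $\widetilde\theta_i$ for the coefficients of $\widetilde\Theta_t$; the linear coefficient $\theta_1$ is called the infinitesimal of $\Theta_t$. The trivial deformation is the one with $\theta_i=0$ for all $i\ge1$. Two deformations $\Theta_t=([\cdot,\ldots,\cdot]_{\mathcal{N},t},[\cdot,\ldots,\cdot]_{\mathcal{N}',t},\phi_t)$ and $\widetilde\Theta_t=([\cdot,\ldots,\cdot]^{\sim}_{\mathcal{N},t},[\cdot,\ldots,\cdot]^{\sim}_{\mathcal{N}',t},\widetilde\phi_t)$ of $\phi$ are equivalent if there are formal automorphisms $\psi_{\mathcal{N},t}=\sum_{i\ge0}\psi_{\mathcal{N},i}t^i$ of $\mathcal{N}[\![t]\!]$ and $\psi_{\mathcal{N}',t}=\sum_{i\ge0}\psi_{\mathcal{N}',i}t^i$ of $\mathcal{N}'[\![t]\!]$ (coefficients linear endomorphisms of $\mathcal{N}$, resp. $\mathcal{N}'$; $\psi_{\mathcal{N},0}=Id$, $\psi_{\mathcal{N}',0}=Id$) with $\psi_{\mathcal{N},t}([x_1,\ldots,x_n]_{\mathcal{N},t})=[\psi_{\mathcal{N},t}(x_1),\ldots,\psi_{\mathcal{N},t}(x_n)]^{\sim}_{\mathcal{N},t}$,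 similarly for $\psi_{\mathcal{N}',t}$ and the brackets on $\mathcal{N}'$, and $\widetilde\phi_t=\psi_{\mathcal{N}',t}\circ\phi_t\circ\psi_{\mathcal{N},t}^{-1}$. Cohomology. Put $\mathcal{L}(\mathcal{N})=\wedge^{n-1}\mathcal{N}$. For $x=x^1\wedge\cdots\wedge x^{n-1}$, $y=y^1\wedge\cdots\wedge y^{n-1}$: $ad(x).z=[x^1,\ldots,x^{n-1},z]$ for $z\in\mathcal{N}$; $L'(x).w=[\phi(x^1),\ldots,\phi(x^{n-1}),w]'$ for $w\in\mathcal{N}'$; $[x,y]=\sum_{i}y^1\wedge\cdots\wedge(ad(x).y^i)\wedge\cdots\wedge y^{n-1}$. $C^m(\mathcal{N},\mathcal{N}')$ is the space of linear maps $f:\otimes^m\mathcal{L}(\mathcal{N})\wedge\mathcal{N}\to\mathcal{N}'$: linear maps $\mathcal{N}\to\mathcal{N}'$ if $m=0$; if $m\ge1$, linear maps $f(x_1,\ldots,x_m,z)$ on $\mathcal{L}(\mathcal{N})^{\otimes m}\otimes\mathcal{N}$ skew-symmetric in $x_m^1,\ldots,x_m^{n-1},z$ (so $C^1$ consists of skew-symmetric $n$-linear maps). The operator $\delta^{m+1}:C^m(\mathcal{N},\mathcal{N}')\to C^{m+1}(\mathcal{N},\mathcal{N}')$ is $$\begin{aligned}\delta^{m+1}f(x_1,\ldots,x_{m+1},z)=&\sum_{1\le i<j\le m+1}(-1)^i f(x_1,\ldots,\widehat{x}_i,\ldots,x_{j-1},[x_i,x_j],\ldots,x_{m+1},z)\\&+\sum_{i=1}^{m+1}(-1)^i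 f(x_1,\ldots,\widehat{x}_i,\ldots,x_{m+1},ad(x_i).z)\\&+\sum_{i=1}^{m+1}(-1)^{i+1}L'(x_i).f(x_1,\ldots,\widehat{x}_i,\ldots,x_{m+1},z)\\&+(-1)^m\sum_{i=1}^{n-1}[\phi(x_{m+1}^1),\ldots,f(x_1,\ldots,x_m,x_{m+1}^i),\ldots,\phi(x_{m+1}^{n-1}),\phi(z)]'\end{aligned}$$ (with $f(\ldots,x_{m+1}^i)$ in slot $i$). $C^*(\mathcal{N},\mathcal{N})$ and $C^*(\mathcal{N}',\mathcal{N}')$ are given by the same formulas with $\phi$ replaced by the identity. Set $C^{-1}=0$ and $C^m(\phi,\phi)=C^m(\mathcal{N},\mathcal{N})\oplus C^m(\mathcal{N}',\mathcal{N}')\oplus C^{m-1}(\mathcal{N},\mathcal{N}')$ (the module of $(m+1)$-cochains of $\phi$), with $\delta^{m+1}(\varphi_1,\varphi_2,\varphi_3)=(\delta^{m+1}\varphi_1,\delta^{m+1}\varphi_2,\delta^m\varphi_3+(-1)^m(\phi\circ\varphi_1-\varphi_2\circ(\bar\phi^{\otimes m}\wedge\phi)))$, where $\bar\phi(x^1\wedge\cdots\wedge x^{n-1})=\phi(x^1)\wedge\cdots\wedge\phi(x^{n-1})$ and $(\bar\phi^{\otimes m}\wedge\phi)(x_1,\ldots,x_m,z)=(\bar\phi(x_1),\ldots,\bar\phi(x_m),\phi(z))$. Then $Z^2(\phi,\phi)=\ker(\delta^2:C^1(\phi,\phi)\to C^2(\phi,\phi))$ (the $2$-cocycles), $B^2(\phi,\phi)=\delta^1(C^0(\phi,\phi))$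 (the $2$-coboundaries), $H^2(\phi,\phi)=Z^2(\phi,\phi)/B^2(\phi,\phi)$.
   Formalization: In (2), false for trivial Θ_t (by (1) all equivalent infinitesimals lie in B²), it is assumed that Θ_t is not equivalent to a trivial deformation; the brackets of Θ̃_t may change, and its first nonzero coefficient θ̃_k, k≥1, replaces θ̃_1. *)

(* Defs.v *)
From HB Require Import structures.
From mathcomp Require Import all_boot all_order all_algebra all_fingroup.
From mathcomp Require Import boolp classical_sets functions.

Set Implicit Arguments.
Unset Strict Implicit.
Unset Printing Implicit Defensive.

Import GRing.Theory.
Local Open Scope ring_scope.

(* Throughout, the arity of the brackets is n = p.+1, so that an element
   x^1 /\ ... /\ x^(n-1) of L(N) is given by a p-tuple 'I_p -> N. *)

Definition upd (n : nat) (V : Type) (x : 'I_n -> V) (i : 'I_n) (v : V) :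
    'I_n -> V :=
  fun j => if j == i then v else x j.

(* (x^1, ..., x^p), z  |->  (x^1, ..., x^p, z) *)
Definition snoc (V : Type) (p : nat) (x : 'I_p -> V) (z : V) : 'I_p.+1 -> V :=
  fun i => if unlift ord_max i is Some k then x k else z.

Section NLieAlgebras.
Variable K : fieldType.

Definition multilinear (n : nat) (V W : lmodType K) (f : ('I_n -> V) -> W) :=
  forall (x : 'I_n -> V) (i : 'I_n), linear (fun v => f (upd x i v)).

Definition skew_symmetric (n : nat) (V W : lmodType K)
    (f : ('I_n -> V) -> W) :=
  forall (s : {perm 'I_n}) (x : 'I_n -> V),
    f (x \o s) = ((-1) ^+ s : K) *: f x.

Definition nambu_identity (p : nat) (V : zmodType)
    (br : ('I_p.+1 -> V) -> V) :=
  forall (x : 'I_p -> V) (y : 'I_p.+1 -> V),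
    br (snoc x (br y))
    = \sum_(i < p.+1) br (upd y i (br (snoc x (y i)))).

Definition nlie_bracket (p : nat) (V : lmodType K)
    (br : ('I_p.+1 -> V) -> V) :=
  [/\ multilinear br, skew_symmetric br & nambu_identity br].

Definition nlie_morphism (p : nat) (V V' : lmodType K)
    (br : ('I_p.+1 -> V) -> V) (br' : ('I_p.+1 -> V') -> V')
    (phi : V -> V') :=
  linear phi /\ forall x, phi (br x) = br' (phi \o x).

End NLieAlgebras.

Section FormalDeformations.
Variable K : fieldType.

(* V[[t]] is the type nat -> V of sequences of coefficients, with the
   pointwise additive structure of functions. *)

(* For f_t = \sum_i t^i f_i with f_i : V -> W linear, the K[[t]]-linear
   extension V[[t]] -> W[[t]]. *)
Definition ext_lin (V W : zmodType) (f : nat -> V -> W)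
    (x : nat -> V) : nat -> W :=
  fun k => \sum_(i < k.+1) f i (x (k - i)%N).

(* For B_t = \sum_i t^i B_i with B_i : V^n -> W multilinear, the
   K[[t]]-multilinear extension: the coefficient of t^k collects the
   B_i (x_1,j_1 , ..., x_n,j_n) such that i + j_1 + ... + j_n = k. *)
Definition ext_mul (n : nat) (V W : zmodType) (B : nat -> ('I_n -> V) -> W)
    (x : 'I_n -> nat -> V) : nat -> W :=
  fun k => \sum_(i < k.+1)
    \sum_(j : {ffun 'I_n -> 'I_k.+1} | (i + \sum_(l < n) j l == k)%N)
      B i (fun l => x l (j l)).

Definition formal_deformation (p : nat) (V : lmodType K)
    (br : ('I_p.+1 -> V) -> V) (B : nat -> ('I_p.+1 -> V) -> V) :=
  [/\ B 0%N = br,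
      forall i, multilinear (B i),
      forall i, skew_symmetric (B i)
    & nambu_identity (ext_mul B)].

(* Coefficients of a triple ([..]_{N,t}, [..]_{N',t}, phi_t). *)
Record triple (p : nat) (N N' : lmodType K) := Triple {
  brN : nat -> ('I_p.+1 -> N) -> N ;
  brN' : nat -> ('I_p.+1 -> N') -> N' ;
  mor : nat -> N -> N' }.

Variables (p : nat) (N N' : lmodType K).

Definition deformation (br : ('I_p.+1 -> N) -> N)
    (br' : ('I_p.+1 -> N') -> N') (phi : N -> N') (T : triple p N N') :=
  [/\ formal_deformation br (brN T),
      formal_deformation br' (brN' T),
      mor T 0%N = phi,
      forall i, linear (mor T i)
    & forall x : 'I_p.+1 -> nat -> N,
        ext_lin (mor T) (ext_mul (brN T) x)
        = ext_mul (brN' T) (fun i => ext_lin (mor T) (x i))].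

(* psi_t = \sum_i t^i psi_i, and psiV is the inverse of psi_t on V[[t]]. *)
Definition formal_automorphism (V : lmodType K) (psi : nat -> V -> V)
    (psiV : (nat -> V) -> (nat -> V)) :=
  [/\ psi 0%N = id, forall i, linear (psi i),
      cancel (ext_lin psi) psiV & cancel psiV (ext_lin psi)].

Definition equivalent (T T' : triple p N N') :=
  exists psi psiV psi' psiV',
  [/\ @formal_automorphism N psi psiV,
      @formal_automorphism N' psi' psiV',
      forall x : 'I_p.+1 -> nat -> N,
        ext_lin psi (ext_mul (brN T) x)
        = ext_mul (brN T') (fun i => ext_lin psi (x i)),
      forall x : 'I_p.+1 -> nat -> N',
        ext_lin psi' (ext_mul (brN' T) x)
        = ext_mul (brN' T') (fun i => ext_lin psi' (x i))
    & forall x : nat -> N,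
        ext_lin (mor T') x = ext_lin psi' (ext_lin (mor T) (psiV x))].

End FormalDeformations.

(* A linear map on L(N)^{(x) m} (x) N is encoded, through the universal
   properties of tensor and exterior powers, by a function of the entries
   x j k = x_j^k (j < m, k < p) and of z; conditions (ii) and (iii) of
   [is_cochain] say that it factors through the exterior power in each x_j. *)
Definition cochain (p m : nat) (V W : Type) :=
  ('I_m -> 'I_p -> V) -> V -> W.

Section Cochains.
Variable K : fieldType.

Definition is_cochain (p m : nat) (V W : lmodType K)
    (f : cochain p m V W) :=
  [/\ (* (i) *) forall x, linear (f x),
      (* (ii) *) forall x z j k,
        linear (fun v => f (upd x j (upd (x j) k v)) z),
      (* (iii) *) forall x z j (s : {perm 'I_p}),
        f (upd x j (x j \o s)) z = ((-1) ^+ s : K) *: f x z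
    & (* skew-symmetry in x_m^1, ..., x_m^(n-1), z *)
      forall x z (j : 'I_m) (s : {perm 'I_p.+1}), j.+1 = m ->
        let w := snoc (x j) z \o s in
        f (upd x j (fun k => w (lift ord_max k))) (w ord_max)
        = ((-1) ^+ s : K) *: f x z].

Variables (p : nat) (V W : lmodType K).
Variables (br : ('I_p.+1 -> V) -> V) (br' : ('I_p.+1 -> W) -> W).
Variable phi : V -> W.

Definition ad (x : 'I_p -> V) (z : V) : V := br (snoc x z).

Definition L' (x : 'I_p -> V) (w : W) : W := br' (snoc (phi \o x) w).

(* delta^(m+1) : C^m(V, W) -> C^(m+1)(V, W).  Indices start at 0, hence the
   shift in the exponents of -1; [x \o lift i] omits x_i; the inner sum over k
   is the expansion of the argument
   [x_i, x_j] = \sum_k x_j^1 /\ ... /\ ad(x_i).x_j^k /\ ... /\ x_j^(n-1). *)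
Definition delta (m : nat) (f : cochain p m V W) : cochain p m.+1 V W :=
  fun x z =>
    \sum_(i < m.+1) \sum_(j < m.+1 | (i < j)%N) ((-1) ^+ i.+1 : K) *:
       \sum_(k < p)
         f (upd x j (upd (x j) k (ad (x i) (x j k))) \o lift i)
           z
  + \sum_(i < m.+1) ((-1) ^+ i.+1 : K) *: f (x \o lift i) (ad (x i) z)
  + \sum_(i < m.+1) ((-1) ^+ i : K) *: L' (x i) (f (x \o lift i) z)
  + ((-1) ^+ m : K) *: \sum_(k < p)
       br' (snoc (upd (phi \o x ord_max) k
                        (f (x \o lift ord_max) (x ord_max k))) (phi z)).

(* The spaces C^(m-1)(V, W), with C^(-1) = 0 as the null subspace of the
   type of 0-cochains, and delta^m : C^(m-1)(V, W) -> C^m(V, W). *)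
Definition is_pred_cochain (m : nat) : cochain p m.-1 V W -> Prop :=
  if m is m'.+1 then fun f => is_cochain (f : cochain p m' V W)
  else fun f => f = 0.

Definition pred_delta (m : nat) : cochain p m.-1 V W -> cochain p m V W :=
  match m with
  | 0%N => fun _ => 0
  | m'.+1 => fun f => delta (f : cochain p m' V W)
  end.

End Cochains.

Section MorphismCohomology.
Variables (K : fieldType) (p : nat) (N N' : lmodType K).
Variables (br : ('I_p.+1 -> N) -> N) (br' : ('I_p.+1 -> N') -> N').
Variable phi : N -> N'.

Local Open Scope classical_set_scope.

Definition mcochain (m : nat) : Type :=
  cochain p m N N * cochain p m N' N' * cochain p m.-1 N N'.

(* C^m(phi, phi) *)
Definition Cphi (m : nat) : set (mcochain m) :=
  [set c | [/\ is_cochain c.1.1, is_cochain c.1.2 & is_pred_cochain c.2]].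

(* delta^(m+1) : C^m(phi, phi) -> C^(m+1)(phi, phi) *)
Definition delta_phi (m : nat) (c : mcochain m) : mcochain m.+1 :=
  (delta br br id c.1.1,
   delta br' br' id c.1.2,
   fun x z => pred_delta br br' phi c.2 x z
     + ((-1) ^+ m : K) *:
         (phi (c.1.1 x z) - c.1.2 (fun j k => phi (x j k)) (phi z))).

Definition Z2 : set (mcochain 1) := [set c | Cphi c /\ delta_phi c = 0].

Definition B2 : set (mcochain 1) := @delta_phi 0 @` @Cphi 0.

(* The class of c modulo B2. *)
Definition coho_class (c : mcochain 1) : set (mcochain 1) :=
  [set c' | B2 (c' - c)].

Definition H2 : set (set (mcochain 1)) := coho_class @` Z2.

End MorphismCohomology.

(* theta_i, viewed in C^1(phi, phi). *)
Definition theta (K : fieldType) (p : nat) (N N' : lmodType K)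
    (T : triple p N N') (i : nat) : mcochain p N N' 1 :=
  ((fun x z => brN T i (snoc (x ord0) z)),
   (fun x z => brN' T i (snoc (x ord0) z)),
   (fun _ z => mor T i z)).

Definition is_trivial (K : fieldType) (p : nat) (N N' : lmodType K)
    (T : triple p N N') :=
  forall i, (0 < i)%N -> theta T i = 0.

Definition equivalent_to_trivial (K : fieldType) (p : nat)
    (N N' : lmodType K) (br : ('I_p.+1 -> N) -> N)
    (br' : ('I_p.+1 -> N') -> N') (phi : N -> N') (T : triple p N N') :=
  exists T0, [/\ deformation br br' phi T0, is_trivial T0 & equivalent T T0].

(* Main.v *)
Require Import Defs.
From HB Require Import structures.
From mathcomp Require Import all_boot all_order all_algebra all_fingroup.
From mathcomp Require Import boolp classical_sets functions.
From mathcomp Require Import zify.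

Set Implicit Arguments.
Unset Strict Implicit.
Unset Printing Implicit Defensive.

Import GRing.Theory.
Local Open Scope classical_set_scope.
Local Open Scope ring_scope.

(** A deformation can be transported along any pair of formal automorphisms
    psi_t, psi'_t that start with the identity: replace the bracket B_t by
    psi_t o B_t o psi_t^-1, and likewise for the other bracket and for the
    morphism.  The point is that these composites are again given by power
    series of coefficients.  On V[[t]], seen as sequences, the extensions of
    coefficient series are exactly the maps that are K-linear in each argument
    and commute with the multiplication by t ([tlinear], [tmultilinear]); such
    maps are determined by their values on constant series
    ([eq_tmultilinear]), and conversely each of them is the extension of its
    coefficients on constants ([tmultilinear_coefs]).

    Everything else is a comparison of single coefficients.  If x and x' agree
    below degree k > 0, the coefficients of degree k of B_t(x) and B_t(x')
    differ by the sum over the slots l of B_0 with x_l replaced by the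
    difference of the coefficients of degree k ([ext_mul_variation]).
    - If theta_1, ..., theta_(k-1) vanish, only B_0 and B_k contribute to the
      coefficient of degree k of the Nambu identity and of the morphism
      identity, and what remains is the cocycle equation for theta_k
      ([theta_cocycle]).  For k = 1 there is no condition.
    - The coefficient of degree 1 of an equivalence psi_t, psi'_t says that
      the two infinitesimals differ by the coboundary of (psi_1, psi'_1, 0)
      ([equivalent_infinitesimal]).
    - Let (psi_t, psi'_t) carry the deformation to one that is trivial below
      degree k.  If theta_k of the result is the coboundary of (g, g', 0),
      adding g to psi_k and g' to psi'_k makes the result trivial in degree k
      too ([rectifying_step]).  Coefficients below k are untouched, so if
      theta_k is a coboundary at every stage the successive corrections
      define a limit that carries the deformation to a trivial one.
      Hence a deformation that is not equivalent to a trivial one meets a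
      stage where theta_k is a cocycle and not a coboundary
      ([obstruction]), which cannot happen when H^2 vanishes. *)

(** * Linear maps and functions of finitely many arguments *)

Section LinearFunctions.
Variables (K : fieldType) (V W : lmodType K) (f : V -> W) (f_lin : linear f).

Let F : {linear V -> W} := HB.pack f (GRing.isLinear.Build K V W _ f f_lin).

Lemma lin0 : f 0 = 0. Proof. exact: (raddf0 F). Qed.
Lemma linD u v : f (u + v) = f u + f v. Proof. exact: (raddfD F). Qed.
Lemma linB u v : f (u - v) = f u - f v. Proof. exact: (raddfB F). Qed.
Lemma lin_sum (I : Type) (r : seq I) (P : pred I) (E : I -> V) :
  f (\sum_(i <- r | P i) E i) = \sum_(i <- r | P i) f (E i).
Proof. exact: (raddf_sum F). Qed.

End LinearFunctions.

Section Slots.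
Variables (n : nat) (V : Type).
Implicit Types (x : 'I_n -> V) (l : 'I_n).

Lemma upd_same x l u : upd x l u l = u.
Proof. by rewrite /upd eqxx. Qed.

Lemma upd_self x l : upd x l (x l) = x.
Proof. by apply/funext => j; rewrite /upd; case: eqP => [->|]. Qed.

Lemma comp_upd (W : Type) (h : V -> W) x l u :
  (fun j => h (upd x l u j)) = upd (fun j => h (x j)) l (h u).
Proof. by apply/funext => j; rewrite /upd; case: eqP. Qed.

Lemma upd_perm x l u (s : {perm 'I_n}) :
  upd x l u \o s = upd (x \o s) ((s^-1)%g l) u.
Proof.
apply/funext => j; rewrite /upd /=; congr (if _ then _ else _).
by rewrite -(inj_eq (@perm_inj _ s) j) permKV.
Qed.

(** Used with Q the property of being a constant series: a statement on
    series is reduced to constants one argument at a time. *)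
Lemma slotwise_ind (P : ('I_n -> V) -> Prop) (Q : V -> Prop) :
    (forall x, (forall l, Q (x l)) -> P x) ->
    (forall x l, (forall v, Q v -> P (upd x l v)) -> P x) ->
  forall x, P x.
Proof.
move=> Q_P P_slot x.
suff H m : (m <= n)%N ->
    forall x, (forall l : 'I_n, (m <= l)%N -> Q (x l)) -> P x.
  by apply: (H n) => // l; rewrite leqNgt ltn_ord.
elim: m => [_ {}x Qx|m IH lt_mn {}x Qx]; first by apply: Q_P => l; apply: Qx.
apply: (P_slot x (Ordinal lt_mn)) => v Qv; apply: IH; first exact: ltnW.
move=> l; rewrite /upd; case: eqP => // ne; rewrite leq_eqVlt => /orP[/eqP e|].
  by case: ne; apply: val_inj.
exact: Qx.
Qed.

End Slots.

Section Snoc.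
Variables (V : Type) (p : nat).
Implicit Types (x : 'I_p -> V) (z : V).

Lemma snoc_max x z : snoc x z ord_max = z.
Proof. by rewrite /snoc unlift_none. Qed.

Lemma snoc_lift x z k : snoc x z (lift ord_max k) = x k.
Proof. by rewrite /snoc liftK. Qed.

Lemma snocP (P : 'I_p.+1 -> Prop) :
  P ord_max -> (forall k, P (lift ord_max k)) -> forall i, P i.
Proof. by move=> Pm Pl i; case: (unliftP ord_max i) => [k|] ->. Qed.

Lemma snoc_eta (w : 'I_p.+1 -> V) :
  snoc (fun k => w (lift ord_max k)) (w ord_max) = w.
Proof.
by apply/funext => i; elim/snocP: i => [|k]; rewrite !(snoc_max, snoc_lift).
Qed.

Lemma upd_snoc_max x z v : upd (snoc x z) ord_max v = snoc x v.
Proof.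
apply/funext => i; elim/snocP: i => [|k]; rewrite /upd ?eqxx ?snoc_max //.
by rewrite !snoc_lift eq_sym (negPf (neq_lift _ _)).
Qed.

Lemma upd_snoc_lift x z k v :
  upd (snoc x z) (lift ord_max k) v = snoc (upd x k v) z.
Proof.
apply/funext => i; elim/snocP: i => [|j]; rewrite /upd ?snoc_max ?snoc_lift.
  by rewrite (negPf (neq_lift _ _)).
by rewrite (inj_eq lift_inj).
Qed.

End Snoc.

Lemma comp_snoc (V W : Type) (p : nat) (h : V -> W) (x : 'I_p -> V) z :
  (fun j => h (snoc x z j)) = snoc (fun j => h (x j)) (h z).
Proof.
by apply/funext => i; elim/snocP: i => [|k]; rewrite !(snoc_max, snoc_lift).
Qed.

Section Multilinear.
Variables (K : fieldType) (n : nat) (V W : lmodType K).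
Variables (f : ('I_n -> V) -> W) (f_lin : multilinear f).

Lemma multilin0 x l : x l = 0 -> f x = 0.
Proof. by move=> xl; rewrite -(upd_self x l) xl (lin0 (f_lin x l)). Qed.

End Multilinear.

(** * Maps between spaces of power series *)

Section PowerSeries.
Variable K : fieldType.

Lemma fct_linE (T : Type) (V : lmodType K) a (u v : T -> V) k :
  (a *: u + v) k = a *: u k + v k.
Proof. by []. Qed.

Definition tmul (V : zmodType) (x : nat -> V) : nat -> V :=
  fun k => if k is j.+1 then x j else 0.

Definition tconst (V : zmodType) (v : V) : nat -> V :=
  fun k => if k is 0%N then v else 0.

Lemma tconst_tmul (V : zmodType) (x : nat -> V) :
  x = tconst (x 0%N) + tmul (fun k => x k.+1).
Proof.
by apply/funext => -[|k]; rewrite addrfctE /= ?addr0 ?add0r.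
Qed.

Lemma tconst_linear (V : lmodType K) : linear (@tconst V).
Proof.
by move=> a u v; apply/funext => -[|k]; rewrite !fct_linE //= scaler0 addr0.
Qed.

Definition tlinear (V W : lmodType K) (f : (nat -> V) -> nat -> W) :=
  linear f /\ forall x, f (tmul x) = tmul (f x).

Definition tmultilinear n (V W : lmodType K)
    (F : ('I_n -> nat -> V) -> nat -> W) :=
  forall x l, tlinear (fun u => F (upd x l u)).

Lemma ext_lin_tlinear (V W : lmodType K) (f : nat -> V -> W) :
  (forall i, linear (f i)) -> tlinear (ext_lin f).
Proof.
move=> f_lin; split=> [a u v|x]; apply/funext => k.
  rewrite fct_linE /ext_lin scaler_sumr -big_split /=.
  by apply: eq_bigr => i _; rewrite -f_lin.
case: k => [|k]; rewrite /ext_lin /=.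
  by rewrite big_ord1 /= (lin0 (f_lin _)).
rewrite big_ord_recr /= subnn /= (lin0 (f_lin _)) addr0.
by apply: eq_bigr => i _; rewrite subSn // -ltnS.
Qed.

Lemma ext_lin_const (V W : lmodType K) (f : nat -> V -> W) v :
  (forall i, linear (f i)) -> ext_lin f (tconst v) = f^~ v.
Proof.
move=> f_lin; apply/funext => k; rewrite /ext_lin big_ord_recr /= subnn.
rewrite big1 ?add0r // => i _.
by rewrite -[(k - i)%N]prednK ?subn_gt0 //= (lin0 (f_lin _)).
Qed.

Lemma eq_tlinear (V W : lmodType K) (f g : (nat -> V) -> nat -> W) :
  tlinear f -> tlinear g -> (forall v, f (tconst v) = g (tconst v)) -> f = g.
Proof.
move=> [f_lin f_t] [g_lin g_t] fg; apply/funext => x; apply/funext => k.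
elim: k x => [|k IH] x; rewrite [x]tconst_tmul (linD f_lin) (linD g_lin);
by rewrite f_t g_t fg !addrfctE //= IH.
Qed.

(** A series is the sum of a constant and of t times a series.  Induction on
    the degree k disposes of the second summand, because a factor t lowers
    the degree at which the maps are compared. *)
Lemma eq_tmultilinear n (V W : lmodType K)
    (F G : ('I_n -> nat -> V) -> nat -> W) :
    tmultilinear F -> tmultilinear G ->
    (forall v, F (fun l => tconst (v l)) = G (fun l => tconst (v l))) ->
  F = G.
Proof.
move=> F_lin G_lin FG; apply/funext => x; apply/funext => k.
elim: k x => [|k IH]; apply: (slotwise_ind (Q := fun u => exists v, u = tconst v)).
all: try by move=> x /choice[v /funext ->]; rewrite FG.
all: move=> x l FGx; rewrite -(upd_self x l) [x l]tconst_tmul.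
all: have [Fl Ft] := F_lin x l; have [Gl Gt] := G_lin x l.
all: rewrite (linD Fl) (linD Gl) Ft Gt !addrfctE /= FGx; last by eexists.
  by [].
by rewrite IH.
Qed.

End PowerSeries.

Section ExtMul.
Variables (K : fieldType) (n : nat) (V W : lmodType K).
Variables (B : nat -> ('I_n -> V) -> W) (B_lin : forall i, multilinear (B i)).

(** The top coefficient B_k only sees the constant terms of its arguments. *)
Lemma ext_mul_recr x k :
  ext_mul B x k = \sum_(i < k)
    \sum_(j : {ffun 'I_n -> 'I_k.+1} | (i + \sum_(l < n) j l == k)%N)
      B i (fun l => x l (j l)) + B k (fun l => x l 0%N).
Proof.
rewrite /ext_mul big_ord_recr /=; congr (_ + _).
rewrite (big_pred1 [ffun => ord0]) => [|j] /=.
  by congr (B k _); apply/funext => l; rewrite ffunE.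
rewrite -[X in _ == X]addn0 eqn_add2l sum_nat_eq0; apply/forallP/eqP => [H|-> l].
  by apply/ffunP => l; rewrite ffunE; apply/val_inj/eqP/H.
by rewrite ffunE.
Qed.

Lemma ext_mul0 x : ext_mul B x 0 = B 0%N (fun l => x l 0%N).
Proof. by rewrite ext_mul_recr big_ord0 add0r. Qed.

Lemma eq_ext_mul x y k :
  (forall l i, (i <= k)%N -> x l i = y l i) -> ext_mul B x k = ext_mul B y k.
Proof.
move=> xy; apply: eq_bigr => i _; apply: eq_bigr => j _; congr (B i _).
by apply/funext => l; apply: xy; rewrite -ltnS.
Qed.

Lemma ext_mul_const v : ext_mul B (fun l => tconst (v l)) = B^~ v.
Proof.
apply/funext => k; rewrite ext_mul_recr big1 ?add0r // => i _.
apply: big1 => j; have [[l l0] _|H /eqP e] := pselect (exists l, (0 < j l)%N).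
  by apply: (multilin0 (B_lin _) (l := l)) => //; rewrite -[nat_of_ord (j l)]prednK.
move: (ltn_ord i); rewrite -[X in (_ < X)%N]e big1 ?addn0 ?ltnn // => l _.
by apply/eqP; rewrite -leqn0 leqNgt; apply/negP => jl; case: H; exists l.
Qed.

(** Commutation with t in the slot l is a reindexing: the exponents of total
    degree k.+1 with a positive exponent in the slot l correspond to those of
    total degree k, and the exponents with 0 in that slot meet the zero
    constant term of t u. *)
Lemma ext_mul_tmultilinear : tmultilinear (ext_mul B).
Proof.
move=> x l; split=> [a u v|u]; apply/funext => k.
  rewrite fct_linE /ext_mul scaler_sumr -big_split /=.
  apply: eq_bigr => i _; rewrite scaler_sumr -big_split /=.
  apply: eq_bigr => j _; set y := fun l' => x l' (j l').
  have E w : (fun l' => upd x l w l' (j l')) = upd y l (w (j l)).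
    by apply/funext => l'; rewrite /upd; case: eqP => // ->.
  by rewrite !E -B_lin.
case: k => [|k] /=.
  by rewrite ext_mul0 (multilin0 (B_lin _) (l := l)) // upd_same.
rewrite ext_mul_recr (multilin0 (B_lin _) (l := l)) ?upd_same // addr0.
apply: eq_bigr => i _.
rewrite (bigID (fun j : {ffun 'I_n -> 'I_k.+2} => (0 < j l)%N)) /=.
rewrite [X in _ + X]big1 ?addr0 => [|j /andP[_]]; last first.
  rewrite lt0n negbK => /eqP jl.
  by apply: (multilin0 (B_lin _) (l := l)) => //; rewrite upd_same jl.
(* [up] raises the exponent of the slot l by one and [down] lowers it. *)
pose up (j : {ffun 'I_n -> 'I_k.+1}) : {ffun 'I_n -> 'I_k.+2} :=
  [ffun l' => if l' == l then lift ord0 (j l') else widen_ord (leqnSn _) (j l')].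
pose down (j : {ffun 'I_n -> 'I_k.+2}) : {ffun 'I_n -> 'I_k.+1} :=
  [ffun l' => inord (if l' == l then (j l').-1 else j l')].
have sum_up j : (\sum_(l' < n) up j l' = (\sum_(l' < n) j l').+1)%N.
  rewrite [LHS](bigD1 l) //= [in RHS](bigD1 l) //= ffunE eqxx lift0 addSn.
  by congr (_ + _).+1; apply: eq_bigr => l' /negPf ne; rewrite ffunE ne.
rewrite (reindex_onto up down) => [|j /andP[/eqP jk jl]]; last first.
  apply/ffunP => l'; rewrite !ffunE; apply: val_inj; case: eqP => [->|ne] /=.
    rewrite /bump leq0n add1n inordK; first by rewrite prednK.
    by rewrite prednK // -ltnS.
  rewrite inordK //; move: jk; rewrite (bigD1 l) //= (bigD1 l') /=; last by apply/eqP.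
  by lia.
apply: eq_big => [j|j _] /=; rewrite ?sum_up.
  rewrite addnS eqSS ffunE eqxx lift0 ltnS leq0n andbT.
  rewrite (_ : down (up j) == j) ?andbT //; apply/eqP/ffunP => l'.
  by rewrite !ffunE; case: eqP => _; rewrite ?lift0 /= inord_val.
congr (B i _); apply/funext => l'; rewrite /upd ffunE; case: eqP => //= _.
Qed.

End ExtMul.

Section Coefficients.
Variables (K : fieldType) (V W : lmodType K).

Lemma tlinear_coefs (f : (nat -> V) -> nat -> W) :
    tlinear f -> let c i v := f (tconst v) i in
  (forall i, linear (c i)) /\ ext_lin c = f.
Proof.
move=> f_lin c; have c_lin i : linear (c i).
  by move=> a u v; rewrite /c tconst_linear f_lin.1.
split=> //; apply: eq_tlinear => // [|v]; first exact: ext_lin_tlinear.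
by rewrite ext_lin_const.
Qed.

Lemma tmultilinear_coefs n (F : ('I_n -> nat -> V) -> nat -> W) :
    tmultilinear F -> let c i v := F (fun l => tconst (v l)) i in
  (forall i, multilinear (c i)) /\ ext_mul c = F.
Proof.
move=> F_lin c; have c_lin i : multilinear (c i).
  move=> x l a u v; rewrite /c !(comp_upd (@tconst V)) tconst_linear.
  by rewrite (F_lin _ l).1.
split=> //; apply: eq_tmultilinear => // [|v]; first exact: ext_mul_tmultilinear.
by rewrite ext_mul_const.
Qed.

Lemma tlinear_comp (U : lmodType K) (f : (nat -> V) -> nat -> W)
  (g : (nat -> U) -> nat -> V) : tlinear f -> tlinear g -> tlinear (f \o g).
Proof.
move=> [f_lin f_t] [g_lin g_t].
by split=> [a u v|x] /=; rewrite ?g_lin ?f_lin ?g_t ?f_t.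
Qed.

Lemma ext_mul_skew n (B : nat -> ('I_n -> V) -> W) (s : {perm 'I_n}) x :
    (forall i, multilinear (B i)) -> (forall i, skew_symmetric (B i)) ->
  ext_mul B (x \o s) = ((-1) ^+ s : K) *: ext_mul B x.
Proof.
(* Both sides are multilinear over K[[t]], so constant arguments suffice. *)
move=> B_lin B_skew; have B_t := ext_mul_tmultilinear B_lin.
pose F (y : 'I_n -> nat -> V) := ext_mul B (y \o s).
pose G (y : 'I_n -> nat -> V) := ((-1) ^+ s : K) *: ext_mul B y.
rewrite -/(F x) -/(G x); congr (_ x); apply: eq_tmultilinear => [y l|y l|v].
- have -> : (fun u => F (upd y l u))
      = (fun u => ext_mul B (upd (y \o s) ((s^-1)%g l) u)).
    by apply/funext => u; rewrite /F upd_perm.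
  exact: B_t.
- have [Bl Bt] := B_t y l; rewrite /G; split=> [a u w|u].
    by rewrite Bl scalerDr !scalerA mulrC.
  by rewrite Bt; apply/funext => -[|k] //=; rewrite scalrfctE scaler0.
rewrite /F /G !ext_mul_const //.
by apply/funext => k; rewrite scalrfctE -B_skew.
Qed.

End Coefficients.

(** * Formal automorphisms and transport of deformations *)

Section FormalAutomorphisms.
Variables (K : fieldType) (V : lmodType K).

(** A t-adic contraction has a fixed point: the coefficient of degree k of
    the iterates is stationary after k.+1 steps. *)
Lemma tadic_fixpoint (S : (nat -> V) -> nat -> V) :
    (forall k u v, (forall j, (j < k)%N -> u j = v j) -> S u k = S v k) ->
  exists u, S u = u.
Proof.
move=> S_contr; pose a m := iter m S 0.
have stable : forall k m, (k < m)%N -> a m k = a k.+1 k.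
  elim/ltn_ind => k IH [//|m] le_km; apply: S_contr => j jk.
  exact: etrans (IH j jk m (leq_trans jk le_km)) (esym (IH j jk k jk)).
exists (fun k => a k.+1 k); apply/funext => k.
by apply: S_contr => j jk; rewrite -(stable j k).
Qed.

Variables (psi : nat -> V -> V).
Hypotheses (psi0 : psi 0%N = id) (psi_lin : forall i, linear (psi i)).

Lemma ext_lin_recl x k :
  ext_lin psi x k = x k + \sum_(i < k) psi i.+1 (x (k - i.+1)%N).
Proof. by rewrite /ext_lin big_ord_recl psi0 subn0. Qed.

(** Solving psi_t(x) = y amounts to finding a fixed point of
    x |-> y - (psi_t - id)(x), and psi_t - id raises the degree. *)
Lemma formal_automorphism_inv : exists psiV, formal_automorphism psi psiV.
Proof.
have psi_inj : injective (ext_lin psi).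
  move=> x y exy; apply/funext => k; elim/ltn_ind: k => k IH.
  have := congr1 (@^~ k) exy; rewrite /= !ext_lin_recl.
  rewrite (eq_bigr (fun i : 'I_k => psi i.+1 (y (k - i.+1)%N))) => [|i _].
    exact: addIr.
  by rewrite IH // ltn_subrL (leq_trans _ (ltn_ord i)).
have /choice[psiV psiK] : forall y, exists x, ext_lin psi x = y.
  move=> y.
  have [|x Sx] := @tadic_fixpoint
    (fun x k => y k - \sum_(i < k) psi i.+1 (x (k - i.+1)%N)).
    move=> k u v uv; congr (_ - _); apply: eq_bigr => i _.
    by rewrite uv // ltn_subrL (leq_trans _ (ltn_ord i)).
  exists x; apply/funext => k; rewrite ext_lin_recl -[X in X k + _]Sx.
  by rewrite subrK.
by exists psiV; split=> // x; apply: psi_inj.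
Qed.

Variables (psiV : (nat -> V) -> nat -> V).
Hypothesis psi_aut : formal_automorphism psi psiV.

Lemma ext_lin_coef0 x : ext_lin psi x 0 = x 0%N.
Proof. by rewrite ext_lin_recl big_ord0 addr0. Qed.

Lemma aut_inv_coef0 x : psiV x 0%N = x 0%N.
Proof. by case: psi_aut => _ _ _ psiK; rewrite -ext_lin_coef0 psiK. Qed.

Lemma aut_inv_tlinear : tlinear psiV.
Proof.
case: psi_aut => _ _ psiVK psiK; have [psi_l psi_t] := ext_lin_tlinear psi_lin.
have psi_inj := can_inj psiVK.
by split=> [a u v|x]; apply: psi_inj; rewrite ?psi_l ?psi_t !psiK.
Qed.

End FormalAutomorphisms.

Section Transport.
Variable K : fieldType.

(** The new bracket is the series of coefficients of
    psi_t o B_t o psi_t^-1, and the Nambu identity is transported as an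
    identity between operators on V[[t]]. *)
Lemma transport_bracket (p : nat) (V : lmodType K)
    (br : ('I_p.+1 -> V) -> V) (B : nat -> ('I_p.+1 -> V) -> V) psi psiV :
    formal_deformation br B -> formal_automorphism psi psiV ->
  exists2 B', formal_deformation br B'
    & forall x, ext_lin psi (ext_mul B x) = ext_mul B' (fun i => ext_lin psi (x i)).
Proof.
case=> B0 B_lin B_skew B_nambu psi_aut; have [psi0 psi_lin psiVK psiK] := psi_aut.
pose F x := ext_lin psi (ext_mul B (fun i => psiV (x i))).
have [psi_l psi_t] := ext_lin_tlinear psi_lin.
have F_lin : tmultilinear F.
  move=> x l; have -> : (fun u => F (upd x l u)) = ext_lin psi \o
      ((fun w => ext_mul B (upd (fun i => psiV (x i)) l w)) \o psiV).
    by apply/funext => u; rewrite /F comp_upd.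
  apply: tlinear_comp; first by split.
  apply: tlinear_comp; first exact: ext_mul_tmultilinear.
  exact: (aut_inv_tlinear psi_lin psi_aut).
have [] := tmultilinear_coefs F_lin; set B' := fun i v => _ => B'_lin B'_F.
exists B'; last first.
  move=> x; rewrite B'_F /F; congr (ext_lin psi (ext_mul B _)).
  by apply/funext => i; rewrite psiVK.
split=> // [|i s x|x y].
- apply/funext => x; rewrite /B' /F (ext_lin_coef0 psi0) ext_mul0 // B0.
  congr (br _); apply/funext => l.
  by rewrite (aut_inv_coef0 psi0 psi_aut).
- rewrite /B' /F; set z := fun i => psiV (tconst (x i)).
  by rewrite [X in ext_mul B X](_ : _ = z \o s) // ext_mul_skew //
             (scalable_linear psi_l).
rewrite B'_F /F (comp_snoc psiV) psiVK B_nambu (lin_sum psi_l).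
apply: eq_bigr => i _; congr (ext_lin psi (ext_mul B _)).
by rewrite comp_upd psiVK (comp_snoc psiV).
Qed.

Variables (p : nat) (N N' : lmodType K).
Variables (br : ('I_p.+1 -> N) -> N) (br' : ('I_p.+1 -> N') -> N').
Variable phi : N -> N'.

Lemma transport_deformation (T : triple p N N') psi psi' :
    deformation br br' phi T ->
    psi 0%N = id -> (forall i, linear (psi i)) ->
    psi' 0%N = id -> (forall i, linear (psi' i)) ->
  exists T', [/\ deformation br br' phi T', equivalent T T',
    forall x, ext_lin psi (ext_mul (brN T) x)
              = ext_mul (brN T') (fun i => ext_lin psi (x i)),
    forall x, ext_lin psi' (ext_mul (brN' T) x)
              = ext_mul (brN' T') (fun i => ext_lin psi' (x i))
  & forall x, ext_lin (mor T') (ext_lin psi x)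
              = ext_lin psi' (ext_lin (mor T) x)].
Proof.
case=> T_br T_br' mor0 mor_lin mor_hom psi0 psi_lin psi'0 psi'_lin.
have [psiV psi_aut] := formal_automorphism_inv psi0 psi_lin.
have [psi'V psi'_aut] := formal_automorphism_inv psi'0 psi'_lin.
have [B B_def psiB] := transport_bracket T_br psi_aut.
have [B' B'_def psi'B'] := transport_bracket T_br' psi'_aut.
have [_ _ psiVK psiK] := psi_aut.
pose f := ext_lin psi' \o (ext_lin (mor T) \o psiV).
have f_lin : tlinear f.
  apply: tlinear_comp; first exact: ext_lin_tlinear.
  apply: tlinear_comp; first exact: ext_lin_tlinear.
  exact: (aut_inv_tlinear psi_lin psi_aut).
have [] := tlinear_coefs f_lin; set m := fun i v => _ => m_lin m_f.
have mE x : ext_lin m (ext_lin psi x) = ext_lin psi' (ext_lin (mor T) x).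
  by rewrite m_f /f /= psiVK.
exists (Triple B B' m); split=> //.
- split=> //= [|x].
    apply/funext => z; rewrite /m /f /= (ext_lin_coef0 psi'0) /ext_lin big_ord1 /=.
    by rewrite (aut_inv_coef0 psi0 psi_aut) mor0.
  have -> : x = fun i => ext_lin psi (psiV (x i)).
    by apply/funext => i; rewrite psiK.
  rewrite -psiB mE mor_hom psi'B'; congr (ext_mul B' _).
  by apply/funext => i; rewrite mE.
- by exists psi, psiV, psi', psi'V; split=> // x; rewrite /= m_f.
Qed.

End Transport.

(** * Variation of a single coefficient *)

Section Variation.
Variables (K : fieldType) (n : nat) (V W : lmodType K).
Variables (B : nat -> ('I_n -> V) -> W) (B_lin : forall i, multilinear (B i)).

Lemma ext_mul_lead x l w k : (forall j, (j < k)%N -> w j = 0) ->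
  ext_mul B (upd x l w) k = B 0%N (upd (fun l' => x l' 0%N) l (w k)).
Proof.
elim: k w => [|k IH] w w0; first by rewrite ext_mul0 // (comp_upd (@^~ 0%N)).
rewrite [w]tconst_tmul w0 // (lin0 (@tconst_linear K V)) add0r.
by rewrite (ext_mul_tmultilinear B_lin x l).2 /= IH // => j jk; apply: w0.
Qed.

Lemma ext_mul_slot_variation x l u u' k :
    (forall j, (j < k)%N -> u' j = u j) ->
  ext_mul B (upd x l u') k = ext_mul B (upd x l u) k
    + B 0%N (upd (fun l' => x l' 0%N) l (u' k - u k)).
Proof.
move=> uu'; have [Bl _] := ext_mul_tmultilinear B_lin x l.
rewrite -(@ext_mul_lead x l (u' - u) k) => [|j jk].
  by rewrite (linB Bl) addrC -[LHS](subrK (ext_mul B (upd x l u) k)).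
by rewrite addrfctE opprfctE uu' // subrr.
Qed.

(** The arguments are changed one slot at a time; since 0 < k, the constant
    terms that enter each variation do not depend on the slots already
    changed. *)
Lemma ext_mul_variation x x' k :
    (0 < k)%N -> (forall l j, (j < k)%N -> x' l j = x l j) ->
  ext_mul B x' k = ext_mul B x k
    + \sum_(l < n) B 0%N (upd (fun l' => x l' 0%N) l (x' l k - x l k)).
Proof.
move=> k0 xx'; pose y m := fun l : 'I_n => if (l < m)%N then x' l else x l.
(* [y m] interpolates between x and x': its first m slots are those of x'. *)
suff H m : (m <= n)%N -> ext_mul B (y m) k = ext_mul B x k
    + \sum_(l < n | (l < m)%N)
        B 0%N (upd (fun l' => x l' 0%N) l (x' l k - x l k)).
  have yn : y n = x' by apply/funext => l; rewrite /y ltn_ord.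
  by rewrite -[in LHS]yn H //; congr (_ + _); apply: eq_bigl => l; rewrite ltn_ord.
elim: m => [_|m IH lt_mn]; first by rewrite big1 ?addr0.
rewrite (bigD1 (Ordinal lt_mn)) //= addrCA addrC.
rewrite (eq_bigl (fun l : 'I_n => (l < m)%N)) => [|l]; last first.
  by rewrite ltnS (leq_eqVlt l) -val_eqE /=; case: ltngtP.
rewrite -(IH (ltnW lt_mn)); set l := Ordinal lt_mn.
have -> : y m.+1 = upd (y m) l (x' l).
  apply/funext => i; rewrite /upd /y; case: eqP => [->|/eqP]; first by rewrite /= ltnSn.
  by rewrite ltnS (leq_eqVlt i) -val_eqE /= => /negPf->.
have {2}-> : y m = upd (y m) l (x l).
  by rewrite -[LHS](upd_self _ l) {2}/y /= ltnn.
rewrite (@ext_mul_slot_variation (y m) l (x l) (x' l) k) => [|j jk]; last exact: xx'.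
congr (_ + B 0%N (upd _ _ _)); apply/funext => i.
by rewrite /y; case: ifP => // _; rewrite xx'.
Qed.

Lemma tconst_multilinear (f : ('I_n -> V) -> W) :
  multilinear f -> forall i, multilinear (tconst f i).
Proof.
by move=> f_lin [//|i] x l a u v /=; rewrite scaler0 addr0.
Qed.

(** Here [tconst (B 0)] is the constant deformation, with vanishing
    coefficients in positive degree. *)
Lemma ext_mul_flat x k :
    (0 < k)%N -> (forall i, (0 < i < k)%N -> B i = 0) ->
  ext_mul B x k = ext_mul (tconst (B 0%N)) x k + B k (fun l => x l 0%N).
Proof.
move=> k0 B_flat; have B0_lin := tconst_multilinear (B_lin 0%N).
rewrite !ext_mul_recr //.
rewrite -addrA; congr (_ + _); last by case: (k) k0 => //= ?; rewrite add0r.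
apply: eq_bigr => i _; apply: eq_bigr => j _.
by case: i => -[|i] //= ik; rewrite B_flat.
Qed.

End Variation.

(** * Rectification of one bracket *)

Section Coboundary.
Variables (K : fieldType) (p : nat).

(** The coboundary of the 0-cochain g with coefficients in V; it vanishes
    when g is a derivation. *)
Definition der_cob (V : lmodType K) (br : ('I_p.+1 -> V) -> V) (g : V -> V) y :=
  \sum_(l < p.+1) br (upd y l (g (y l))) - g (br y).

(** Modulo t^k, psi_t intertwines B_t and the undeformed bracket.  Only the
    coefficients of psi_t below k occur, which is what makes corrections in
    successive degrees converge. *)
Definition rectifies (V : lmodType K) (br : ('I_p.+1 -> V) -> V)
    (B : nat -> ('I_p.+1 -> V) -> V) (psi : nat -> V -> V) k :=
  forall i x, (i < k)%N ->
    ext_lin psi (B^~ x) i = ext_mul (tconst br) (fun l => psi^~ (x l)) i.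

Lemma eq_rectifies (V : lmodType K) (br : ('I_p.+1 -> V) -> V) B
    (psi psi_ : nat -> V -> V) k :
    (forall i, (i < k)%N -> psi_ i = psi i) ->
  rectifies br B psi k -> rectifies br B psi_ k.
Proof.
move=> eq_psi psi_rect i x ik; transitivity (ext_lin psi (B^~ x) i).
  by apply: eq_bigr => j _; rewrite eq_psi // (leq_trans _ ik) // ltnS -ltnS.
rewrite psi_rect //; apply: eq_ext_mul => l j ji.
by rewrite eq_psi // (leq_ltn_trans ji).
Qed.

Section Bracket.
Variables (V : lmodType K) (br : ('I_p.+1 -> V) -> V) (br_lin : multilinear br).
Variables (B B' : nat -> ('I_p.+1 -> V) -> V).
Hypotheses (B_lin : forall i, multilinear (B i)).
Hypotheses (B'_lin : forall i, multilinear (B' i)) (B'0 : B' 0%N = br).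
Variable psi : nat -> V -> V.
Hypotheses (psi0 : psi 0%N = id) (psi_lin : forall i, linear (psi i)).
Hypothesis psiB : forall x,
  ext_lin psi (ext_mul B x) = ext_mul B' (fun i => ext_lin psi (x i)).

(** When B'_t is trivial below degree k, its coefficient B'_k is the defect of
    psi_t from intertwining B_t and the undeformed bracket in degree k. *)
Lemma bracket_defect k x :
    (0 < k)%N -> (forall i, (0 < i < k)%N -> B' i = 0) ->
  ext_lin psi (B^~ x) k
    = ext_mul (tconst br) (fun l => psi^~ (x l)) k + B' k x.
Proof.
move=> k0 B'_flat; rewrite -(ext_mul_const B_lin) psiB ext_mul_flat // B'0.
have -> : (fun l => ext_lin psi (tconst (x l))) = fun l => psi^~ (x l).
  by apply/funext => l; rewrite ext_lin_const.
by congr (_ + B' k _); apply/funext => l; rewrite ext_lin_coef0.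
Qed.

(** By induction on i: below degree i the new bracket is trivial, so B'_i is
    the defect of psi_t in degree i, which is zero. *)
Lemma rectifies_flat k :
  rectifies br B psi k -> forall i, (0 < i < k)%N -> B' i = 0.
Proof.
move=> psi_rect; elim/ltn_ind => i IH /andP[i0 ik]; apply/funext => x.
have := psi_rect i x ik; rewrite bracket_defect // => [/eqP|j /andP[j0 ji]].
  by rewrite -[X in _ == X]addr0 (inj_eq (addrI _)) => /eqP.
by rewrite IH // j0 (ltn_trans ji).
Qed.

(** Adding g to psi_k changes the coefficient of degree k by g([x]) on one
    side and by the sum of the [.., g x_l, ..] on the other: the difference is
    the coboundary of g, which compensates the defect B'_k. *)
Lemma rectifies_step k g (psi_ : nat -> V -> V) :
    (0 < k)%N -> rectifies br B psi k -> B 0%N = br -> B' k = der_cob br g ->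
    (forall i, (i < k)%N -> psi_ i = psi i) ->
    (forall z, psi_ k z = psi k z + g z) ->
  rectifies br B psi_ k.+1.
Proof.
move=> k0 psi_rect B0 B'k eq_psi psi_k i x; rewrite ltnS leq_eqVlt => /orP[/eqP->|ik].
  rewrite (ext_mul_variation (tconst_multilinear br_lin)
             (x := fun l => psi^~ (x l))) //= => [|l j jk]; last by rewrite eq_psi.
  rewrite /ext_lin big_ord_recr /= subnn psi_k B0.
  rewrite (eq_bigr (fun i : 'I_k => psi i (B (k - i)%N x))) => [|j _]; last first.
    by rewrite eq_psi.
  have := @bracket_defect k x k0 (rectifies_flat psi_rect).
  rewrite /ext_lin big_ord_recr /= subnn B0 addrA => ->; rewrite B'k /der_cob -!addrA.
  congr (_ + _); rewrite addNr addr0 psi0; apply: eq_bigr => l _.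
  by rewrite psi_k addrC addKr.
exact: (eq_rectifies eq_psi psi_rect).
Qed.

End Bracket.

End Coboundary.

(** * Rectification of the morphism *)

Section Morphisms.
Variables (K : fieldType) (V W : lmodType K).

Lemma ext_lin_flat (m : nat -> V -> W) (x : nat -> V) k :
    (0 < k)%N -> (forall i, (0 < i < k)%N -> m i = 0) ->
  ext_lin m x k = m 0%N (x k) + m k (x 0%N).
Proof.
case: k => // k _ m_flat; rewrite /ext_lin big_ord_recl big_ord_recr /= subn0 subnn.
by rewrite big1 ?add0r // => i _; rewrite m_flat // ltnS ltn_ord.
Qed.

(** Modulo t^k, psi_t and psi'_t intertwine m_t and the undeformed
    morphism. *)
Definition rectifies_mor (phi : V -> W) (m : nat -> V -> W)
    (psi : nat -> V -> V) (psi' : nat -> W -> W) k :=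
  forall i z, (i < k)%N -> phi (psi i z) = ext_lin psi' (m^~ z) i.

Lemma eq_rectifies_mor phi m psi psi_ psi' psi'_ k :
    (forall i, (i < k)%N -> psi_ i = psi i) ->
    (forall i, (i < k)%N -> psi'_ i = psi' i) ->
  rectifies_mor phi m psi psi' k -> rectifies_mor phi m psi_ psi'_ k.
Proof.
move=> eq_psi eq_psi' rect i z ik; rewrite eq_psi // rect //.
by apply: eq_bigr => j _; rewrite eq_psi' // (leq_trans _ ik) // ltnS -ltnS.
Qed.

Variables (phi : V -> W) (m m' : nat -> V -> W).
Variables (psi : nat -> V -> V) (psi' : nat -> W -> W).
Hypotheses (phi_lin : linear phi) (m_lin : forall i, linear (m i)).
Hypotheses (m0 : m 0%N = phi) (m'0 : m' 0%N = phi) (psi0 : psi 0%N = id).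
Hypotheses (psi_lin : forall i, linear (psi i)).
Hypothesis psi_m :
  forall x, ext_lin m' (ext_lin psi x) = ext_lin psi' (ext_lin m x).

Lemma morphism_defect k z :
    (0 < k)%N -> (forall i, (0 < i < k)%N -> m' i = 0) ->
  ext_lin psi' (m^~ z) k = phi (psi k z) + m' k z.
Proof.
move=> k0 m'_flat; have := congr1 (@^~ k) (psi_m (tconst z)).
by rewrite /= !ext_lin_const // ext_lin_flat // m'0 psi0.
Qed.

Lemma rectifies_mor_flat k :
  rectifies_mor phi m psi psi' k -> forall i, (0 < i < k)%N -> m' i = 0.
Proof.
move=> rect; elim/ltn_ind => i IH /andP[i0 ik]; apply/funext => z.
have := rect i z ik; rewrite morphism_defect // => [/eqP|j /andP[j0 ji]].
  by rewrite -[X in X == _]addr0 (inj_eq (addrI _)) eq_sym => /eqP.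
by rewrite IH // j0 (ltn_trans ji).
Qed.

(** The corrections g and g' made for the two brackets change the two sides
    by phi g and g' phi; the third component of the coboundary is precisely
    phi g - g' phi. *)
Lemma rectifies_mor_step k g g' psi_ psi'_ :
    (0 < k)%N -> rectifies_mor phi m psi psi' k ->
    (forall z, m' k z = phi (g z) - g' (phi z)) ->
    (forall i, (i < k)%N -> psi_ i = psi i) ->
    (forall i, (i < k)%N -> psi'_ i = psi' i) ->
    (forall z, psi_ k z = psi k z + g z) ->
    (forall z, psi'_ k z = psi' k z + g' z) ->
  rectifies_mor phi m psi_ psi'_ k.+1.
Proof.
move=> k0 rect m'k eq_psi eq_psi' psi_k psi'_k i z.
rewrite ltnS leq_eqVlt => /orP[/eqP->|ik]; last first.
  exact: (eq_rectifies_mor eq_psi eq_psi' rect).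
have := @morphism_defect k z k0 (rectifies_mor_flat rect).
rewrite /ext_lin !big_ord_recr /= subnn psi_k psi'_k m0 m'k (linD phi_lin).
rewrite [in X in _ -> X](eq_bigr (fun i : 'I_k => psi' i (m (k - i)%N z))) => [|j _].
  2: by rewrite eq_psi'.
by rewrite !addrA => ->; rewrite subrK.
Qed.

End Morphisms.

(** * The identities satisfied by the first nonzero coefficient *)

Section InfinitesimalIdentities.
Variables (K : fieldType) (p k : nat).
Hypothesis k0 : (0 < k)%N.

Lemma ext_mul_insert n (V W : lmodType K) (B : nat -> ('I_n -> V) -> W) z l u :
    (forall i, multilinear (B i)) -> (forall j, (0 < j < k)%N -> u j = 0) ->
  ext_mul B (upd (fun i => tconst (z i)) l u) k
    = B k (upd z l (u 0%N)) + B 0%N (upd z l (u k)).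
Proof.
move=> B_lin u_flat.
rewrite (@ext_mul_slot_variation _ _ _ _ B B_lin _ l (tconst (u 0%N)) u k).
  rewrite -(comp_upd (@tconst V)) ext_mul_const //; congr (_ + B _ (upd _ _ _)).
  by case: (k) k0 => //= j _; rewrite subr0.
by case=> [|j] //= jk; rewrite u_flat.
Qed.

(** The coefficient of degree k of the Nambu identity on constants: in each
    composite of two brackets, one of them must contribute B_k and the other
    B_0. *)
Lemma nambu_infinitesimal (V : lmodType K) (br : ('I_p.+1 -> V) -> V) B x y :
    formal_deformation br B -> (forall i, (0 < i < k)%N -> B i = 0) ->
  B k (snoc x (br y)) + br (snoc x (B k y))
    = \sum_(l < p.+1) B k (upd y l (br (snoc x (y l))))
      + \sum_(l < p.+1) br (upd y l (B k (snoc x (y l)))).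
Proof.
case=> B0 B_lin _ B_nambu B_flat; have B_const := ext_mul_const B_lin.
have := congr1 (@^~ k) (B_nambu (fun i => tconst (x i)) (fun i => tconst (y i))).
rewrite /= fct_sumE B_const; have u_flat w j : (0 < j < k)%N -> B j w = 0.
  by move=> jk; rewrite B_flat.
rewrite -(upd_snoc_max _ (tconst 0)) -(comp_snoc (@tconst V)).
rewrite (ext_mul_insert _ _ B_lin (u_flat y)).
rewrite !upd_snoc_max /= B0 => ->; rewrite -big_split; apply: eq_bigr => l _.
by rewrite -(comp_snoc (@tconst V)) B_const (ext_mul_insert _ _ B_lin (u_flat _)) /= B0.
Qed.

Lemma morphism_infinitesimal (V W : lmodType K) (phi : V -> W)
    (B : nat -> ('I_p.+1 -> V) -> V) (B' : nat -> ('I_p.+1 -> W) -> W) m y :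
    (forall i, multilinear (B i)) -> (forall i, multilinear (B' i)) ->
    (forall i, linear (m i)) -> m 0%N = phi ->
    (forall i, (0 < i < k)%N -> m i = 0) ->
    (forall x, ext_lin m (ext_mul B x) = ext_mul B' (fun i => ext_lin m (x i))) ->
  phi (B k y) + m k (B 0%N y)
    = B' k (phi \o y) + \sum_(l < p.+1) B' 0%N (upd (phi \o y) l (m k (y l))).
Proof.
move=> B_lin B'_lin m_lin m0 m_flat m_hom.
have := congr1 (@^~ k) (m_hom (fun i => tconst (y i))).
rewrite /= ext_mul_const // ext_lin_flat // m0 => ->.
rewrite (ext_mul_variation B'_lin (x := fun l => tconst (phi (y l)))) //.
  rewrite ext_mul_const //; congr (_ + _); apply: eq_bigr => l _.
  rewrite ext_lin_const //; congr (B' _ (upd _ _ _)).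
  by case: (k) k0 => //= j _; rewrite subr0.
by move=> l [|j] jk; rewrite ext_lin_const //= ?m0 // m_flat.
Qed.

End InfinitesimalIdentities.

Lemma sum_ord2 (V : zmodType) (F : 'I_2 -> V) :
  \sum_(i < 2) F i = F ord0 + F ord_max.
Proof.
by rewrite big_ord_recl big_ord1; congr (_ + F _); apply: val_inj.
Qed.

Lemma sum_ord2_lt (V : zmodType) (F : 'I_2 -> 'I_2 -> V) :
  \sum_(i < 2) \sum_(j < 2 | (i < j)%N) F i j = F ord0 ord_max.
Proof.
rewrite sum_ord2 (big_pred1 ord_max) => [|[[|[|]]] //].
by rewrite big_pred0 ?addr0 // => -[[|[|]]].
Qed.

(** * Cocycles and coboundaries in low degree *)

Section Cohomology.
Variables (K : fieldType) (p : nat) (N N' : lmodType K).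
Variables (br : ('I_p.+1 -> N) -> N) (br' : ('I_p.+1 -> N') -> N').
Variable phi : N -> N'.

(** The term L'(x) g(z) is the summand of the last slot. *)
Lemma delta0E (V W : lmodType K) (b : ('I_p.+1 -> V) -> V)
    (b' : ('I_p.+1 -> W) -> W) (h : V -> W) (g : V -> W) x z :
    let y := snoc (x ord0) z in
  delta (m := 0) b b' h (fun _ => g) x z
    = \sum_(l < p.+1) b' (upd (h \o y) l (g (y l))) - g (b y).
Proof.
move=> y; rewrite /delta !big_ord1 [X in X + _ + _ + _]big_pred0 ?add0r.
  2: by move=> j; rewrite [j]ord1.
rewrite expr1 expr0 !scale1r scaleN1r (ord1 ord_max) -/y -addrA addrC.
congr (_ - _); rewrite [RHS](bigD1_ord ord_max) //=.
have -> : h \o y = snoc (h \o x ord0) (h z) by exact: comp_snoc.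
rewrite upd_snoc_max /y snoc_max; congr (_ + _).
by apply: eq_bigr => l _; rewrite upd_snoc_lift snoc_lift.
Qed.

(** Written with y = (x_2, z), the sum over the entries of [x_1, x_2] and the
    term in ad(x_1) z together run over all the slots of y, and so do the last
    sum of the coboundary and the term in L'(x_2). *)
Lemma delta1E (V W : lmodType K) (b : ('I_p.+1 -> V) -> V)
    (b' : ('I_p.+1 -> W) -> W) (h : V -> W) (f : ('I_p.+1 -> V) -> W) x z :
    let y := snoc (x ord_max) z in
  delta (m := 1) b b' h (fun x z => f (snoc (x ord0) z)) x z
    = f (snoc (x ord0) (b y)) + b' (snoc (h \o x ord0) (f y))
      - \sum_(l < p.+1) f (upd y l (b (snoc (x ord0) (y l))))
      - \sum_(l < p.+1) b' (upd (h \o y) l (f (snoc (x ord0) (y l)))).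
Proof.
have e1 : lift ord0 ord0 = ord_max :> 'I_2 by apply: val_inj.
have e2 : lift ord_max ord0 = ord0 :> 'I_2 by apply: val_inj.
move=> y; have hy : h \o y = snoc (h \o x ord_max) (h z) by exact: comp_snoc.
rewrite /delta sum_ord2_lt !sum_ord2 /= e1 e2.
rewrite expr0 expr1 sqrrN expr1n !scaleN1r !scale1r /ad /L'.
rewrite (bigD1_ord ord_max (F := fun l => f _)) //=.
rewrite (bigD1_ord ord_max (F := fun l => b' _)) //= hy /y !upd_snoc_max !snoc_max.
set S1 := \sum_(k < p) f _; set S2 := \sum_(k < p) b' _.
set S3 := \sum_(k < p) f _; set S4 := \sum_(k < p) b' _.
have -> : S1 = S3.
  by apply: eq_bigr => l _; rewrite upd_same upd_snoc_lift snoc_lift.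
have -> : S2 = S4.
  by apply: eq_bigr => l _; rewrite upd_snoc_lift snoc_lift.
rewrite !opprD !addrA; congr (_ - _ - _).
by rewrite [LHS](ACl (3 * 4 * 2 * 1)%AC).
Qed.

Lemma bracket_cochain (V W : lmodType K) (f : ('I_p.+1 -> V) -> W) :
    multilinear f -> skew_symmetric f ->
  is_cochain (m := 1) (fun x z => f (snoc (x ord0) z)).
Proof.
move=> f_lin f_skew; split.
- move=> x a u v; have := f_lin (snoc (x ord0) 0) ord_max a u v.
  by rewrite !upd_snoc_max.
- move=> x z j l a u v; rewrite (ord1 j) !upd_same.
  by rewrite -!upd_snoc_lift f_lin.
- move=> x z j s; rewrite (ord1 j) upd_same.
  have -> : snoc (x ord0 \o s) z = snoc (x ord0) z \o lift_perm ord_max ord_max s.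
    apply/funext => i; elim/snocP: i => [|i] /=.
      by rewrite lift_perm_id !snoc_max.
    by rewrite lift_perm_lift !snoc_lift.
  by rewrite f_skew odd_lift_perm addbb.
- by move=> x z j s _ w; rewrite /w (ord1 j) upd_same snoc_eta f_skew.
Qed.

Lemma linear_cochain (V W : lmodType K) (g : V -> W) :
  linear g -> is_cochain (p := p) (m := 0) (fun _ => g).
Proof. by split=> // ? ? []. Qed.

Lemma theta_eq0 (T : triple p N N') i : theta T i = 0 <->
  [/\ brN T i = 0, brN' T i = 0 & mor T i = 0].
Proof.
split=> [[e1 e2 e3]|[e1 e2 e3]]; last by rewrite /theta e1 e2 e3.
split; apply/funext => y.
- by rewrite -(snoc_eta y); apply: (congr1 (fun f => f (fun _ k => y _) _) e1).
- by rewrite -(snoc_eta y); apply: (congr1 (fun f => f (fun _ k => y _) _) e2).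
- exact: (congr1 (fun f => f (fun _ _ => 0) y) e3).
Qed.

(** The coefficients of degree k of the two Nambu identities and of the
    morphism identity are the three components of the cocycle equation. *)
Lemma theta_cocycle (T : triple p N N') k :
    deformation br br' phi T -> (0 < k)%N ->
    (forall i, (0 < i < k)%N -> theta T i = 0) ->
  Z2 br br' phi (theta T k).
Proof.
move=> [T_br T_br' mor0 mor_lin mor_hom] k0 T_flat.
have [B0 B_lin B_skew _] := T_br; have [B'0 B'_lin B'_skew _] := T_br'.
have flat i ik := (theta_eq0 T i).1 (T_flat i ik).
split; first split.
- exact: bracket_cochain.
- exact: bracket_cochain.
- exact: linear_cochain.
congr (_, _, _); apply/funext => x; apply/funext => z.
- rewrite /= delta1E (nambu_infinitesimal k0 _ _ T_br) => [|i ik].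
    by rewrite addrAC addrK subrr.
  by case: (flat i ik).
- rewrite /= delta1E (nambu_infinitesimal k0 _ _ T_br') => [|i ik].
    by rewrite addrAC addrK subrr.
  by case: (flat i ik).
rewrite /= delta0E expr1 scaleN1r opprB.
set y := snoc _ _; have -> : snoc (fun l => phi (x ord0 l)) (phi z) = phi \o y.
  by rewrite -comp_snoc.
rewrite addrACA -opprD addrC [_ + brN' T k _]addrC.
rewrite -B0 -B'0 -(morphism_infinitesimal k0 y B_lin B'_lin mor_lin mor0 _ mor_hom).
  by rewrite [mor T k _ + _]addrC addNr.
by move=> i /flat[].
Qed.

(** This is the image of (g, g', 0) under the coboundary operator; the third
    component of a 0-cochain of phi lies in the null space C^(-1). *)
Definition coboundary (g : N -> N) (g' : N' -> N') : mcochain p N N' 1 :=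
  (fun x z => der_cob br g (snoc (x ord0) z),
   fun x z => der_cob br' g' (snoc (x ord0) z),
   fun _ z => phi (g z) - g' (phi z)).

Lemma B2P c : B2 br br' phi c <->
  exists g g', [/\ linear g, linear g' & c = coboundary g g'].
Proof.
have cob g g' : delta_phi (m := 0) br br' phi ((fun _ => g), (fun _ => g'), 0)
    = coboundary g g'.
  congr (_, _, _); apply/funext => x; apply/funext => z.
  - by rewrite /= delta0E.
  - by rewrite /= delta0E.
  by rewrite /= add0r expr0 scale1r.
have const0 (V : lmodType K) (f : cochain p 0 V V) : f = fun _ => f (fun _ _ => 0).
  by apply/funext => x; congr f; apply/funext => -[].
split=> [[[[f f'] f3] [/= [f_lin _ _ _] [f'_lin _ _ _] f30] <-]|[g [g' [gl g'l ->]]]].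
  exists (f (fun _ _ => 0)), (f' (fun _ _ => 0)); split=> //.
  by rewrite -cob f30 -!const0.
exists ((fun _ => g), (fun _ => g'), 0); last exact: cob.
by split=> //=; apply: linear_cochain.
Qed.

Lemma theta_coboundary (T : triple p N N') k g g' :
  theta T k = coboundary g g' ->
  [/\ brN T k = der_cob br g, brN' T k = der_cob br' g'
    & forall z, mor T k z = phi (g z) - g' (phi z)].
Proof.
case=> e1 e2 e3; split=> [||z]; try (apply/funext => y; rewrite -(snoc_eta y)).
- exact: (congr1 (fun f => f (fun _ k => y (lift ord_max k)) (y ord_max)) e1).
- exact: (congr1 (fun f => f (fun _ k => y (lift ord_max k)) (y ord_max)) e2).
- exact: (congr1 (fun f => f (fun _ _ => 0) z) e3).
Qed.

Hypotheses (br_lin : multilinear br) (br'_lin : multilinear br').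
Hypothesis phi_lin : linear phi.

Lemma der_cob_linear (V : lmodType K) (b : ('I_p.+1 -> V) -> V) a g h y :
    multilinear b ->
  der_cob b (a *: g + h) y = a *: der_cob b g y + der_cob b h y.
Proof.
move=> b_lin; rewrite /der_cob scalerBr addrACA -opprD scaler_sumr -big_split /=.
by congr (_ - _); apply: eq_bigr => l _; rewrite b_lin.
Qed.

Lemma coboundary_linear a g g' h h' :
  coboundary (a *: g + h) (a *: g' + h') = a *: coboundary g g' + coboundary h h'.
Proof.
congr (_, _, _); apply/funext => x; apply/funext => z.
- exact: der_cob_linear.
- exact: der_cob_linear.
by rewrite !fct_linE phi_lin scalerBr addrACA -opprD.
Qed.

End Cohomology.

(** * Equivalences and the obstruction to triviality *)

Section Equivalence.
Variables (K : fieldType) (p : nat) (N N' : lmodType K).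
Variables (br : ('I_p.+1 -> N) -> N) (br' : ('I_p.+1 -> N') -> N').
Variable phi : N -> N'.
Hypotheses (br_lin : multilinear br) (br'_lin : multilinear br').
Hypothesis phi_lin : linear phi.

Lemma B2_linear a c d :
  B2 br br' phi c -> B2 br br' phi d -> B2 br br' phi (a *: c + d).
Proof.
move=> /B2P[g [g' [g_lin g'_lin ->]]] /B2P[h [h' [h_lin h'_lin ->]]].
apply/B2P; exists (a *: g + h), (a *: g' + h').
have comb (V : lmodType K) (f f' : V -> V) :
    linear f -> linear f' -> linear (a *: f + f').
  move=> f_lin f'_lin b u v; rewrite !fct_linE f_lin f'_lin !scalerDr addrACA.
  by rewrite !scalerA [a * b]mulrC.
by split; rewrite ?coboundary_linear //; apply: comb.
Qed.

Lemma B2_0 : B2 br br' phi 0.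
Proof.
have c0 : B2 br br' phi (coboundary br br' phi 0 0).
  by apply/B2P; exists 0, 0; split=> // a u v; rewrite scaler0 addr0.
by have := B2_linear (-1) c0 c0; rewrite scaleN1r addNr.
Qed.

Lemma eq_coho_class c d :
  B2 br br' phi (c - d) -> coho_class br br' phi c = coho_class br br' phi d.
Proof.
move=> cd; apply/seteqP; split=> e /= ce.
  by have := B2_linear 1 ce cd; rewrite scale1r subrKA.
by have := B2_linear (-1) cd ce; rewrite scaleN1r opprB addrC subrKA.
Qed.

Lemma first_order_bracket (V : lmodType K) (b : ('I_p.+1 -> V) -> V)
    (B B' : nat -> ('I_p.+1 -> V) -> V) (psi : nat -> V -> V) x :
    multilinear b -> (forall i, multilinear (B i)) ->
    (forall i, multilinear (B' i)) -> B 0%N = b -> B' 0%N = b ->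
    psi 0%N = id -> (forall i, linear (psi i)) ->
    (forall x, ext_lin psi (ext_mul B x) = ext_mul B' (fun i => ext_lin psi (x i))) ->
  B 1%N x - B' 1%N x = der_cob b (psi 1%N) x.
Proof.
move=> b_lin B_lin B'_lin B0 B'0 psi0 psi_lin psiB.
have := bracket_defect B_lin B'_lin B'0 psi0 psi_lin psiB (k := 1) x.
have tb_lin := tconst_multilinear b_lin.
rewrite (ext_mul_variation tb_lin (x := fun l => tconst (x l))) //; last first.
  by move=> l [|j] //= _; rewrite psi0.
rewrite ext_mul_const // add0r /ext_lin big_ord_recl big_ord1 /= psi0 B0.
have -> : \sum_(l < p.+1) b (upd (fun l' => x l') l (psi 1%N (x l) - 0))
    = \sum_(l < p.+1) b (upd x l (psi 1%N (x l))).
  by apply: eq_bigr => l _; rewrite subr0.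
move=> E; apply/eqP; rewrite subr_eq /der_cob addrAC -E ?addrK //.
by case.
Qed.

(** The coefficient of degree 1 of the equivalence is linear in
    (psi_1, psi'_1), which gives the cochain that bounds the difference. *)
Lemma equivalent_infinitesimal (T T' : triple p N N') :
    deformation br br' phi T -> deformation br br' phi T' -> equivalent T T' ->
  B2 br br' phi (theta T 1 - theta T' 1).
Proof.
move=> [[B0 B_lin _ _] [B'0 B'_lin _ _] m0 m_lin _].
move=> [[C0 C_lin _ _] [C'0 C'_lin _ _] m'0 m'_lin _].
case=> psi [psiV [psi' [psi'V [psi_aut psi'_aut psiB psi'B psi_m]]]].
have [psi0 psi_lin psiVK _] := psi_aut; have [psi'0 psi'_lin _ _] := psi'_aut.
apply/B2P; exists (psi 1%N), (psi' 1%N); split=> //.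
congr (_, _, _); apply/funext => x; apply/funext => z.
- exact: first_order_bracket.
- exact: first_order_bracket.
have psi_m' y : ext_lin (mor T') (ext_lin psi y) = ext_lin psi' (ext_lin (mor T) y).
  by rewrite psi_m psiVK.
have := morphism_defect m_lin m'0 psi0 psi_lin psi_m' (k := 1) z.
rewrite /ext_lin big_ord_recl big_ord1 /= psi'0 m0.
move=> /(_ isT) E; apply/eqP; rewrite subr_eq addrAC -E ?addrK //.
by case.
Qed.

Variable T : triple p N N'.
Hypothesis T_def : deformation br br' phi T.

(** Stage k of the construction of an equivalence of T with a trivial
    deformation. *)
Record rectifying k (psi : (nat -> N -> N) * (nat -> N' -> N')) := Rectifying {
  rect0 : psi.1 0%N = id;
  rect0' : psi.2 0%N = id;
  rect_lin : forall i, linear (psi.1 i);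
  rect_lin' : forall i, linear (psi.2 i);
  rect_br : rectifies br (brN T) psi.1 k;
  rect_br' : rectifies br' (brN' T) psi.2 k;
  rect_mor : rectifies_mor phi (mor T) psi.1 psi.2 k }.

Lemma rectifying1 : rectifying 1 (tconst id, tconst id).
Proof.
have [[B0 B_lin _ _] [B'0 B'_lin _ _] m0 m_lin _] := T_def.
have t_lin (V : lmodType K) i : linear (tconst (id : V -> V) i).
  by case: i => // i a u v /=; rewrite scaler0 addr0.
split=> //= [i x|i x|i z]; rewrite ltnS leqn0 => /eqP->.
- by rewrite ext_mul0 ?/ext_lin ?big_ord1 ?B0 //; apply: tconst_multilinear.
- by rewrite ext_mul0 ?/ext_lin ?big_ord1 ?B'0 //; apply: tconst_multilinear.
by rewrite /ext_lin big_ord1 /= m0.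
Qed.

Definition transports (psi : (nat -> N -> N) * (nat -> N' -> N'))
    (T' : triple p N N') :=
  [/\ deformation br br' phi T', equivalent T T',
    forall x, ext_lin psi.1 (ext_mul (brN T) x)
              = ext_mul (brN T') (fun i => ext_lin psi.1 (x i)),
    forall x, ext_lin psi.2 (ext_mul (brN' T) x)
              = ext_mul (brN' T') (fun i => ext_lin psi.2 (x i))
  & forall x, ext_lin (mor T') (ext_lin psi.1 x)
              = ext_lin psi.2 (ext_lin (mor T) x)].

Lemma rectifying_transport k psi :
  rectifying k psi -> exists T', transports psi T'.
Proof. by case=> *; apply: transport_deformation. Qed.

Lemma rectifying_flat k psi T' : rectifying k psi -> transports psi T' ->
  forall i, (0 < i < k)%N -> theta T' i = 0.
Proof.
case=> psi0 psi'0 psi_lin psi'_lin rect rect' rectm.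
case=> [[C C' m'0 _ _] _ psiB psi'B psi_m] i ik.
have [[B0 B_lin _ _] [B'0 B'_lin _ _] m0 m_lin _] := T_def.
have [[C0 C_lin _ _] [C'0 C'_lin _ _]] := (C, C').
apply/theta_eq0; split.
- exact: (rectifies_flat B_lin C_lin C0 psi0 psi_lin psiB rect ik).
- exact: (rectifies_flat B'_lin C'_lin C'0 psi'0 psi'_lin psi'B rect' ik).
- exact: (rectifies_mor_flat m_lin m'0 psi0 psi_lin psi_m rectm ik).
Qed.

Lemma rectifying_step k psi T' :
    (0 < k)%N -> rectifying k psi -> transports psi T' ->
    B2 br br' phi (theta T' k) ->
  exists2 psi_, rectifying k.+1 psi_
    & forall i, (i < k)%N -> psi_.1 i = psi.1 i /\ psi_.2 i = psi.2 i.
Proof.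
move=> k0 [psi0 psi'0 psi_lin psi'_lin rect rect' rectm].
case=> [[[C0 C_lin _ _] [C'0 C'_lin _ _] m'0 _ _] _ psiB psi'B psi_m].
case/B2P=> g [g' [g_lin g'_lin]].
have [[B0 B_lin _ _] [B'0 B'_lin _ _] m0 m_lin _] := T_def.
move=> /theta_coboundary[C_g C'_g' m'_g].
pose add (V : lmodType K) (f : nat -> V -> V) (h : V -> V) i :=
  f i + (if i == k then h else 0).
have addE (V : lmodType K) (f : nat -> V -> V) h i : (i < k)%N -> add V f h i = f i.
  by move=> /ltn_eqF ik; rewrite /add ik addr0.
have addk (V : lmodType K) (f : nat -> V -> V) h z : add V f h k z = f k z + h z.
  by rewrite /add eqxx.
have add_lin (V : lmodType K) (f : nat -> V -> V) h :
    (forall i, linear (f i)) -> linear h -> forall i, linear (add V f h i).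
  move=> f_lin h_lin i a u v; rewrite /add !addrfctE; case: eqP => _.
    by rewrite f_lin h_lin scalerDr addrACA.
  by rewrite !addr0 f_lin.
exists (add N psi.1 g, add N' psi.2 g') => [|i ik] /=; last by rewrite !addE.
split=> /=.
- by rewrite addE.
- by rewrite addE.
- exact: add_lin.
- exact: add_lin.
- apply: (rectifies_step br_lin B_lin C_lin C0 psi0 psi_lin psiB (g := g)) => // [|z].
    exact: addE.
  exact: addk.
- apply: (rectifies_step br'_lin B'_lin C'_lin C'0 psi'0 psi'_lin psi'B
            (g := g')) => // [|z].
    exact: addE.
  exact: addk.
- apply: (rectifies_mor_step phi_lin m_lin m0 m'0 psi0 psi_lin psi_m
            (g := g) (g' := g')) => //.
  + exact: addE.
  + exact: addE.
  + by move=> z; apply: addk.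
  + by move=> z; apply: addk.
Qed.

Lemma rectifying_all psi : (forall k, rectifying k psi) ->
  equivalent_to_trivial br br' phi T.
Proof.
move=> rect; have [T' psiT'] := rectifying_transport (rect 0%N).
have [T'_def eqT _ _ _] := psiT'; exists T'; split=> // i i0.
by apply: (rectifying_flat (rect i.+1) psiT'); rewrite i0 leqnn.
Qed.

(** Otherwise every stage can be corrected.  The correction made in degree k
    preserves the coefficients below k, so the coefficients stabilise one by
    one; the limit is at every stage at once, and carries T to a trivial
    deformation. *)
Lemma obstruction :
    ~ equivalent_to_trivial br br' phi T ->
  exists T' k, [/\ deformation br br' phi T', equivalent T T', (0 < k)%N,
    forall i, (0 < i < k)%N -> theta T' i = 0 & ~ B2 br br' phi (theta T' k)].
Proof.
move=> T_nontriv; apply: contrapT => no_obstr; apply: T_nontriv.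
have step (kpsi : nat * ((nat -> N -> N) * (nat -> N' -> N'))) :
    exists psi_, rectifying kpsi.1.+1 kpsi.2 -> rectifying kpsi.1.+2 psi_ /\
      forall i, (i < kpsi.1.+1)%N ->
        psi_.1 i = kpsi.2.1 i /\ psi_.2 i = kpsi.2.2 i.
  case: kpsi => k psi /=.
  have [rect|] := pselect (rectifying k.+1 psi); last by exists psi.
  have [T' psiT'] := rectifying_transport rect.
  have [T'_def eqT _ _ _] := psiT'; have T'_flat := rectifying_flat rect psiT'.
  have cob : B2 br br' phi (theta T' k.+1).
    by apply: contrapT => ncob; apply: no_obstr; exists T', k.+1.
  by have [psi_] := rectifying_step (ltn0Sn k) rect psiT' cob; exists psi_.
have [next nextP] := choice step.
pose s := fix s k := if k is j.+1 then next (j, s j) else (tconst id, tconst id).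
have s_rect k : rectifying k.+1 (s k).
  by elim: k => [|k IH]; [exact: rectifying1|case: (nextP (k, s k))].
have s_stable k i : (i <= k)%N -> (s k).1 i = (s i).1 i /\ (s k).2 i = (s i).2 i.
  elim: k => [|k IH]; first by rewrite leqn0 => /eqP->.
  rewrite leq_eqVlt => /orP[/eqP->//|ik]; have [<- <-] := IH ik.
  by have [_] := nextP (k, s k) (s_rect k); apply.
pose lim := (fun i => (s i).1 i, fun i => (s i).2 i).
apply: (rectifying_all (psi := lim)) => k.
have [psi0 psi'0 psi_lin psi'_lin rect rect' rectm] := s_rect k.
have lim_s i : (i < k.+1)%N -> lim.1 i = (s k).1 i by rewrite ltnS => /s_stable[->].
have lim_s' i : (i < k.+1)%N -> lim.2 i = (s k).2 i by rewrite ltnS => /s_stable[_ ->].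
split=> [||i|i|i x ik|i x ik|i z ik].
- by rewrite lim_s.
- by rewrite lim_s'.
- exact: rect_lin (s_rect i) i.
- exact: rect_lin' (s_rect i) i.
- exact: (eq_rectifies lim_s rect _ (ltnW ik)).
- exact: (eq_rectifies lim_s' rect' _ (ltnW ik)).
- exact: (eq_rectifies_mor lim_s lim_s' rectm _ (ltnW ik)).
Qed.

End Equivalence.

Theorem theorem4p7 (K : closedFieldType) (charK : [pchar K] =i pred0)
    (p : nat) (N N' : lmodType K)
    (br : ('I_p.+1 -> N) -> N) (br' : ('I_p.+1 -> N') -> N') (phi : N -> N')
    (hbr : nlie_bracket br) (hbr' : nlie_bracket br')
    (hphi : nlie_morphism br br' phi)
    (T : triple p N N') (hT : deformation br br' phi T) :
  [/\ (* (1) *)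
      Z2 br br' phi (theta T 1)
      /\ (forall T', deformation br br' phi T' -> equivalent T T' ->
            coho_class br br' phi (theta T' 1)
            = coho_class br br' phi (theta T 1)),
      (* (2) *)
      ~ equivalent_to_trivial br br' phi T ->
      exists T' k,
        [/\ deformation br br' phi T', equivalent T T', (0 < k)%N,
            forall i, (0 < i < k)%N -> theta T' i = 0
          & Z2 br br' phi (theta T' k) /\ ~ B2 br br' phi (theta T' k)]
    & H2 br br' phi = [set coho_class br br' phi 0] ->
      forall T', deformation br br' phi T' ->
        equivalent_to_trivial br br' phi T'].
Proof.
have [br_lin _ _] := hbr; have [br'_lin _ _] := hbr'; have [phi_lin _] := hphi.
have obstr := obstruction br_lin br'_lin phi_lin.
have cocycle := theta_cocycle (br := br) (br' := br') (phi := phi).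
split; first split.
- by apply: cocycle => //; case.
- move=> T' T'_def eqT; apply/esym/eq_coho_class => //.
  exact: equivalent_infinitesimal.
- move=> /(obstr _ hT)[T' [k [T'_def eqT k0 T'_flat ncob]]].
  by exists T', k; split=> //; split=> //; apply: cocycle.
move=> H2_0 T' T'_def; apply: contrapT => /(obstr _ T'_def).
case=> [T'' [k [T''_def _ k0 T''_flat []]]].
have c_Z2 := cocycle _ _ T''_def k0 T''_flat; set c := theta T'' k in c_Z2 *.
have : H2 br br' phi (coho_class br br' phi c) by exists c.
rewrite H2_0 /= => cls; have : coho_class br br' phi c c.
  by rewrite /coho_class /= subrr; apply: B2_0.
by rewrite cls /coho_class /= subr0.
Qed.
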